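(* Let $\mathcal{A}$ be a preorder-enriched category, and let $(r_X:X\to RX)_{X\in\mathcal{A}}$ be a family of arrows such that for every object $X$, $RX$ is a separated object and there exists an arrow $s_X:RX\to X$ such that $(r_X,s_X)$ is an equivalence. Fix such a choice $s_X$ for each $X$. For a preorder-enriched monad $\hat M=(M,\eta,(-)^* )$ on $\mathcal{A}$ define $\mathsf{T}\hat M=(M',\eta',(-)^{*'})$ by $M'X=R(MX)$, $\eta'_X=r_{MX}\circ\eta_X:X\to M'X$, and for $f:X\to M'Y$, $f^{*'}=r_{MY}\circ(s_{MY}\circ f)^*\circ s_{MX}:M'X\to M'Y$; and define $\mathrm{in}_{\hat M,X}=r_{MX}:MX\to M'X$. Then for every preorder-enriched monad $\hat M$ on $\mathcal{A}$, $\mathsf{T}\hat M$ is a preorder-enriched monad on $\mathcal{A}$ and $\mathrm{in}_{\hat M}=(\mathrm{in}_{\hat M,X})_X$ is a monad map from $\hat M$ to $\mathsf{T}\hat M$ (so $(\mathsf{T},\mathrm{in})$ is a basic monad transformer). Moreover, $\mathsf{T}\hat M$ does not depend on the choice of the arrows $s_X$.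
   Context: A preorder-enriched category is a category whose hom-sets $\mathcal{A}(X,Y)$ are preorders and whose composition is monotone in both arguments. Two parallel arrows $f,g$ are equivalent ($f\sim g$) if $f\leq g$ and $g\leq f$. An object $Y$ is separated if $\mathcal{A}(X,Y)$ is a partial order for every object $X$. A pair of arrows $f:X\to Y$, $g:Y\to X$ is an equivalence if $\mathrm{id}_Y\leq f\circ g\leq\mathrm{id}_Y$ and $\mathrm{id}_X\leq g\circ f\leq\mathrm{id}_X$. A preorder-enriched monad on $\mathcal{A}$ is a triple $\hat M=(M,\eta,(-)^* )$ where $M$ maps objects to objects, $\eta_X:X\to MX$ are arrows, and $(-)^*$ is a family of monotone maps $\mathcal{A}(X,MY)\to\mathcal{A}(MX,MY)$, satisfying $\eta_X^*=\mathrm{id}_{MX}$, $f^*\circ\eta_X=f$, and $g^*\circ f^*=(g^*\circ f)^*$. A monad map $\theta$ from $\hat M$ to $\hat M'=(M',\eta',(-)^{*'})$ is a family of arrows $\theta_X:MX\to M'X$ such that $\theta_X\circ\eta_X=\eta'_X$ and $\theta_Y\circ f^*=(\theta_Y\circ f)^{*'}\circ\theta_X$ for every $f:X\to MY$. A basic monad transformer is a pair $(\mathsf{T},\mathrm{in})$ where $\mathsf{T}$ maps preorder-enriched monads to preorder-enriched monads and $\mathrm{in}_{\hat M}$ is a monad map from $\hat M$ to $\mathsf{T}\hat M$. *)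

(* Defs.v *)
From Stdlib Require Import Relations.

Set Implicit Arguments.
Unset Strict Implicit.
Unset Printing Implicit Defensive.

Declare Scope pcat_scope.
Delimit Scope pcat_scope with pcat.
Local Open Scope pcat_scope.

(* The category laws are strict (Leibniz equality of arrows); the preorder on
   hom-sets need not be antisymmetric. *)
Record preorder_category := PreorderCategory {
  obj :> Type;
  hom : obj -> obj -> Type;
  idm : forall X : obj, hom X X;
  comp : forall X Y Z : obj, hom Y Z -> hom X Y -> hom X Z;
  hle : forall X Y : obj, relation (hom X Y);
  comp_idl : forall (X Y : obj) (f : hom X Y), comp (idm Y) f = f;
  comp_idr : forall (X Y : obj) (f : hom X Y), comp f (idm X) = f;
  comp_assoc : forall (X Y Z W : obj) (h : hom Z W) (g : hom Y Z) (f : hom X Y),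
    comp h (comp g f) = comp (comp h g) f;
  hle_preorder : forall X Y : obj, preorder (hom X Y) (@hle X Y);
  comp_monotone : forall (X Y Z : obj) (g g' : hom Y Z) (f f' : hom X Y),
    hle g g' -> hle f f' -> hle (comp g f) (comp g' f')
}.

Arguments hom {p} X Y.
Arguments idm {p} X.
Arguments comp {p X Y Z} g f.
Arguments hle {p X Y} f g.

Notation "g ∘ f" := (comp g f)
  (at level 40, left associativity) : pcat_scope.
Notation "f ⊑ g" := (hle f g) (at level 70, no associativity) : pcat_scope.

Section Notions.

Variable A : preorder_category.

Definition separated (Y : A) : Prop :=
  forall X : A, order (hom X Y) (@hle A X Y).

Definition is_equivalence (X Y : A) (f : hom X Y) (g : hom Y X) : Prop :=
  (idm Y ⊑ f ∘ g /\ f ∘ g ⊑ idm Y) /\ (idm X ⊑ g ∘ f /\ g ∘ f ⊑ idm X).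

(* Bare data (M, eta, ( )^* ), with no law imposed. *)
Record triple := Triple {
  tobj : A -> A;
  unit : forall X : A, hom X (tobj X);
  ext : forall X Y : A, hom X (tobj Y) -> hom (tobj X) (tobj Y)
}.

Definition is_monad (M : triple) : Prop :=
  (forall (X Y : A) (f g : hom X (tobj M Y)), f ⊑ g -> ext f ⊑ ext g) /\
  (forall X : A, ext (unit M X) = idm (tobj M X)) /\
  (forall (X Y : A) (f : hom X (tobj M Y)), ext f ∘ unit M X = f) /\
  (forall (X Y Z : A) (f : hom X (tobj M Y)) (g : hom Y (tobj M Z)),
     ext g ∘ ext f = ext (ext g ∘ f)).

Record monad := Monad {
  monad_triple :> triple;
  monad_laws : is_monad monad_triple
}.

Definition is_monad_map (M M' : triple)
    (theta : forall X : A, hom (tobj M X) (tobj M' X)) : Prop :=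
  (forall X : A, theta X ∘ unit M X = unit M' X) /\
  (forall (X Y : A) (f : hom X (tobj M Y)),
     theta Y ∘ ext f = ext (theta Y ∘ f) ∘ theta X).

(* T is typed with codomain bare data; that its values are monads is part of
   the predicate. *)
Definition is_basic_monad_transformer (T : monad -> triple)
    (inj : forall (M : monad) (X : A), hom (tobj M X) (tobj (T M) X)) : Prop :=
  forall M : monad, is_monad (T M) /\ is_monad_map (inj M).

Section Transformer.

Variables (R : A -> A) (r : forall X : A, hom X (R X))
  (s : forall X : A, hom (R X) X).

Definition sep_triple (M : monad) : triple :=
  @Triple (fun X => R (tobj M X))
    (fun X => r (tobj M X) ∘ unit M X)
    (fun X Y f => r (tobj M Y) ∘ ext (s (tobj M Y) ∘ f) ∘ s (tobj M X)).

Definition sep_in (M : monad) (X : A) :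
  hom (tobj M X) (tobj (sep_triple M) X) := r (tobj M X).

End Transformer.

End Notions.

Arguments separated {A} Y.
Arguments is_equivalence {A X Y} f g.
Arguments is_monad {A} M.
Arguments is_monad_map {A} M M' theta.
Arguments is_basic_monad_transformer {A} T inj.
Arguments sep_triple {A R} r s M.
Arguments sep_in {A R} r s M X.

(* Main.v *)
(* Since RX is separated, r_X ∘ s_X is equal, not just equivalent, to the
   identity, and equivalent arrows into RX are equal. So every law of the
   transformed triple, being an equation between arrows into some RX, need only
   hold up to equivalence, where s_X ∘ r_X cancels and any two choices of s_X
   coincide. *)
Require Import Defs.
From Stdlib Require Import Relations Setoid Morphisms FunctionalExtensionality.

Local Open Scope pcat_scope.

Definition eqv {A : preorder_category} {X Y : A} (f g : hom X Y) : Prop :=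
  f ⊑ g /\ g ⊑ f.

Notation "f ≈ g" := (eqv f g) (at level 70, no associativity) : pcat_scope.

Section Equivalence.

Variable A : preorder_category.

Lemma hle_refl (X Y : A) (f : hom X Y) : f ⊑ f.
Proof. apply (preord_refl _ _ (hle_preorder X Y)). Qed.

Lemma hle_trans (X Y : A) (f g h : hom X Y) : f ⊑ g -> g ⊑ h -> f ⊑ h.
Proof. apply (preord_trans _ _ (hle_preorder X Y)). Qed.

Global Instance eqv_equivalence (X Y : A) : Equivalence (@eqv A X Y).
Proof.
  split.
  - intros f. split; apply hle_refl.
  - intros f g [H1 H2]. split; assumption.
  - intros f g h [H1 H2] [H3 H4]. split; eapply hle_trans; eassumption.
Qed.

Global Instance comp_eqv (X Y Z : A) :
  Proper (eqv ==> eqv ==> eqv) (@comp A X Y Z).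
Proof.
  intros g g' [H1 H2] f f' [H3 H4]. split; apply comp_monotone; assumption.
Qed.

(** Monotonicity of the extension gives this; it allows [s ∘ r] to be cancelled by rewriting under
    [ext]. *)
Global Instance ext_eqv (M : monad A) (X Y : A) :
  Proper (eqv ==> eqv) (@ext A M X Y).
Proof.
  destruct (monad_laws M) as [mono _].
  intros f g [H1 H2]. split; apply mono; assumption.
Qed.

Lemma separated_eq (X Y : A) (f g : hom X Y) : separated Y -> f ≈ g -> f = g.
Proof. intros sepY [H1 H2]. apply (ord_antisym _ _ (sepY X)); assumption. Qed.

Lemma equivalence_eqv_id (X Y : A) (f : hom X Y) (g : hom Y X) :
  is_equivalence f g -> f ∘ g ≈ idm Y /\ g ∘ f ≈ idm X.
Proof. intros [[H1 H2] [H3 H4]]. repeat split; assumption. Qed.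

(** As for inverses in a monoid: [g' ≈ g' ∘ (f ∘ g) = (g' ∘ f) ∘ g ≈ g]. *)
Lemma equivalence_inverse_unique (X Y : A) (f : hom X Y) (g g' : hom Y X) :
  is_equivalence f g -> is_equivalence f g' -> g' ≈ g.
Proof.
  intros [fg _]%equivalence_eqv_id [_ g'f]%equivalence_eqv_id.
  rewrite <- (comp_idr g'), <- fg, comp_assoc, g'f, comp_idl. reflexivity.
Qed.

End Equivalence.

Section SepTriple.

Variables (A : preorder_category) (R : A -> A) (r : forall X : A, hom X (R X)).
Variable s : forall X : A, hom (R X) X.
Hypothesis sepR : forall X : A, separated (R X).
Hypothesis hs : forall X : A, is_equivalence (r X) (s X).

Lemma sep_retraction (X Y : A) (f : hom X (R Y)) : r Y ∘ (s Y ∘ f) = f.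
Proof.
  apply separated_eq; [apply sepR|].
  destruct (equivalence_eqv_id _ _ _ _ _ (hs Y)) as [rs _].
  rewrite comp_assoc, rs, comp_idl. reflexivity.
Qed.

(** Only an equivalence, since [Y] itself need not be separated. The trailing [f] lets it match
    inside right-nested composites. *)
Lemma sep_section (X Y : A) (f : hom X Y) : s Y ∘ (r Y ∘ f) ≈ f.
Proof.
  destruct (equivalence_eqv_id _ _ _ _ _ (hs Y)) as [_ sr].
  rewrite comp_assoc, sr, comp_idl. reflexivity.
Qed.

Lemma sep_triple_is_monad (M : monad A) : is_monad (sep_triple r s M).
Proof.
  destruct (monad_laws M) as (mono & ext_unit & ext_comp_unit & ext_comp).
  repeat split; cbn.
  - intros X Y f g fg.
    repeat (apply comp_monotone || apply mono); auto using hle_refl.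
  - intros X. apply separated_eq; [apply sepR|].
    rewrite sep_section, ext_unit, comp_idr.
    destruct (equivalence_eqv_id _ _ _ _ _ (hs (tobj M X))) as [rs _].
    exact rs.
  - intros X Y f. apply separated_eq; [apply sepR|].
    rewrite <- !comp_assoc, sep_section, ext_comp_unit, sep_retraction.
    reflexivity.
  - intros X Y Z f g. apply separated_eq; [apply sepR|].
    (* One [s ∘ r] cancels between the two extensions on the left, another inside the extended arrow
       on the right; what remains is associativity for [M] at [s ∘ f] and [s ∘ g]. *)
    rewrite <- !comp_assoc, !sep_section.
    rewrite (comp_assoc _ _ (s (tobj M X))), ext_comp. reflexivity.
Qed.

Lemma sep_in_is_monad_map (M : monad A) :
  is_monad_map M (sep_triple r s M) (sep_in r s M).
Proof.
  split; cbn; unfold sep_in.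
  - reflexivity.
  - intros X Y f. apply separated_eq; [apply sepR|].
    (* The final [s ∘ r] has no arrow after it, so it is cancelled by [sr] directly. *)
    destruct (equivalence_eqv_id _ _ _ _ _ (hs (tobj M X))) as [_ sr].
    rewrite sep_section, <- !comp_assoc, sr, comp_idr. reflexivity.
Qed.

Lemma sep_triple_unique (s' : forall X : A, hom (R X) X) (M : monad A) :
  (forall X : A, is_equivalence (r X) (s' X)) ->
  sep_triple r s' M = sep_triple r s M.
Proof.
  (* Objects and units do not mention the inverses, so only the extensions are compared, pointwise
     as arrows into some [R] object. *)
  intros hs'. unfold sep_triple. f_equal.
  extensionality X. extensionality Y. extensionality f.
  apply separated_eq; [apply sepR|].
  assert (ss : forall Z, s' Z ≈ s Z)
    by (intros Z; apply (equivalence_inverse_unique _ _ _ (r Z)); auto).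
  rewrite !ss. reflexivity.
Qed.

End SepTriple.

Theorem theorem2 (A : preorder_category) (R : A -> A)
    (r : forall X : A, hom X (R X))
    (hr : forall X : A,
       separated (R X) /\ exists sX : hom (R X) X, is_equivalence (r X) sX)
    (s : forall X : A, hom (R X) X)
    (hs : forall X : A, is_equivalence (r X) (s X)) :
  (forall M : monad A,
     is_monad (sep_triple r s M) /\
     is_monad_map M (sep_triple r s M) (sep_in r s M)) /\
  is_basic_monad_transformer (sep_triple r s) (sep_in r s) /\
  (forall s' : (forall X : A, hom (R X) X),
     (forall X : A, is_equivalence (r X) (s' X)) ->
     forall M : monad A, sep_triple r s' M = sep_triple r s M).
Proof.
  assert (sepR : forall X, separated (R X)) by (intros X; apply (hr X)).
  assert (transformer : is_basic_monad_transformer (sep_triple r s) (sep_in r s))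
    by (intros M; split;
        [apply sep_triple_is_monad | apply sep_in_is_monad_map]; assumption).
  (* The first conjunct is the transformer predicate unfolded. *)
  split; [exact transformer | split; [exact transformer |]].
  intros s' hs' M. apply sep_triple_unique; assumption.
Qed.
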